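(* Let $\mathfrak{g}=\mathfrak{so}(3,1)$, $\mathfrak{iso}(2,1)$, or $\mathfrak{so}(2,2)$, with symmetric splitting $\mathfrak{g}=\mathfrak{h}\oplus\mathfrak{p}$, $\mathfrak{h}=\mathfrak{so}(2,1)$, and let $\mu$ be a nonzero real number. Let $M$ be an oriented smooth 3-manifold with a coframe field $e\in\Omega^1(M,\mathfrak{p})$, and form a Cartan connection from just the coframe field by $A(e)=\omega(e)+e$, where $\omega(e)\in\Omega^1(M,\mathfrak{h})$ is the torsion-free spin connection of $e$. Then the action for topologically massive gravity, with cosmological constant appropriate to $\mathfrak{g}$, $$S_{\rm TMG}(e)=\int_M\mathrm{tr}\left(-e\wedge{\star R}-\tfrac16e\wedge{\star[e,e]}+\tfrac1{2\mu}\left(\omega\wedge d\omega+\tfrac13\omega\wedge[\omega,\omega]\right)\right),\qquad \omega=\omega(e),\quad R=d\omega+\tfrac12[\omega,\omega],$$ is given, up to boundary terms, by $$S_{\rm TMG}(e)=S^\beta_{\rm CS}(A(e)),$$ where $S^\beta_{\rm CS}(A)=\tfrac12\int_M\beta\left(A\wedge dA+\tfrac13A\wedge[A,A]\right)$ is the Chern–Simons action for the bilinear form $\beta(X,Y)=\mathrm{tr}\left(X\left(\tfrac1\mu-\star\right)Y\right)$ on $\mathfrak{g}$.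
   Context: The model symmetric spaces are $G/H$ with $H=\mathrm{SO}(2,1)$ and $G=\mathrm{SO}(3,1)$ (de Sitter, $\Lambda>0$), $\mathrm{ISO}(2,1)=\mathrm{SO}(2,1)\ltimes\mathbb{R}^{2,1}$ (Minkowski, $\Lambda=0$), or $\mathrm{SO}(2,2)$ (anti de Sitter, $\Lambda<0$); units are chosen so that $\Lambda\in\{+1,0,-1\}$. The splitting $\mathfrak{g}=\mathfrak{h}\oplus\mathfrak{p}$ satisfies $[\mathfrak{h},\mathfrak{h}]\subseteq\mathfrak{h}$, $[\mathfrak{h},\mathfrak{p}]\subseteq\mathfrak{p}$, $[\mathfrak{p},\mathfrak{p}]\subseteq\mathfrak{h}$; here $\mathfrak{h}=\mathfrak{so}(2,1)$ is the stabilizer of a basepoint and $\mathfrak{p}\cong\mathbb{R}^{2,1}$ as an $\mathfrak{h}$-representation (for $\mathfrak{so}(3,1)$ and $\mathfrak{so}(2,2)$, $\mathfrak{p}$ is the Killing-orthogonal complement of $\mathfrak{h}$; for $\mathfrak{iso}(2,1)$, $\mathfrak{p}$ is the abelian translation ideal). Working locally, a coframe field is a $\mathfrak{p}$-valued 1-form $e$ with $e\colon T_xM\to\mathfrak{p}$ an isomorphism for every $x$. The torsion-free spin connection $\omega(e)$ is the unique $\mathfrak{h}$-valued 1-form with $d_{\omega}e=de+[\omega,e]=0$. $\mathrm{tr}$ denotes (a fixed nonzero multiple of) the Killing form of $\mathfrak{g}$, $\mathrm{tr}(XY)$. For $\mathfrak{so}(3,1)$ and $\mathfrak{so}(2,2)$,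 $\star$ is the Hodge star on $\mathfrak{g}\cong\Lambda^2\mathbb{R}^4$ (with the invariant metric and an orientation on $\mathbb{R}^4$); it satisfies $\star[X,Y]=[X,\star Y]$, $\mathrm{tr}(X{\star Y})=\mathrm{tr}(Y{\star X})$, exchanges $\mathfrak{h}$ and $\mathfrak{p}$, and $\star^2=-1$ on $\mathfrak{so}(3,1)$, $\star^2=+1$ on $\mathfrak{so}(2,2)$. For $\mathfrak{iso}(2,1)$, with bases $J_a$ of $\mathfrak{h}$ and $P_a$ of $\mathfrak{p}$ satisfying $[J_a,J_b]=\epsilon_{abc}J^c$, $[J_a,P_b]=\epsilon_{abc}P^c$, $[P_a,P_b]=0$ (indices raised with the Minkowski metric $\eta$), $\mathrm{tr}(X{\star Y})$ denotes the nondegenerate invariant symmetric form (up to a fixed nonzero normalization) with $\mathrm{tr}(J_a{\star P_b})=\mathrm{tr}(P_b{\star J_a})=\eta_{ab}$ and vanishing on $\mathfrak{h}\otimes\mathfrak{h}$ and $\mathfrak{p}\otimes\mathfrak{p}$. In all cases $\mathrm{tr}(X(\frac1\mu-\star)Y)=\frac1\mu\mathrm{tr}(XY)-\mathrm{tr}(X{\star Y})$. For $\mathfrak{g}$-valued forms $\lambda=\lambda^i\otimes v_i$, $\nu=\nu^j\otimes v_j$: $[\lambda,\nu]=(\lambda^i\wedge\nu^j)\otimes[v_i,v_j]$, $\beta(\lambda\wedge\nu)=\beta(v_i,v_j)\lambda^i\wedge\nu^j$, and $\mathrm{tr}(\lambda\wedge\nu)$, $\mathrm{tr}(\lambda\wedge{\star\nu})$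 are defined likewise from the forms $\mathrm{tr}(XY)$, $\mathrm{tr}(X{\star Y})$. ''Up to boundary terms'' means the integrands (with prefactors) differ by an exact form $d\eta$, with $\eta$ a 2-form built from $\omega(e)$ and $e$. *)

(* Defs.v *)
From HB Require Import structures.
From mathcomp Require Import all_boot all_order all_algebra.
From mathcomp Require Import all_classical all_reals all_analysis.

Set Implicit Arguments.
Unset Strict Implicit.
Unset Printing Implicit Defensive.

Import Order.TTheory GRing.Theory Num.Theory.
Import numFieldNormedType.Exports.

Local Open Scope classical_set_scope.
Local Open Scope ring_scope.

Section Smooth.
Variables (R : realType) (V W : normedModType R).

Fixpoint Ck_on (k : nat) (U : set V) (f : V -> W) : Prop :=
  match k with
  | 0 => forall x, U x -> {for x, continuous f}
  | k'.+1 => (forall x, U x -> differentiable f x) /\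
             (forall v, Ck_on k' U (fun x => 'D_v f x))
  end.

Definition smooth_on (U : set V) (f : V -> W) : Prop := forall k, Ck_on k U f.

End Smooth.

(* The structure is presented by an oriented smooth atlas, not necessarily
   maximal.  [mf_chart i] and [mf_inv i] are only meaningful on [mf_dom i] and
   on its image; their values elsewhere are never used. *)
Record oriented_manifold (R : realType) (n : nat) := OrientedManifold {
  mf_space :> topologicalType;
  mf_hausdorff : hausdorff_space mf_space;
  mf_second_countable : @second_countable mf_space;
  mf_index : Type;
  mf_dom : mf_index -> set mf_space;
  mf_chart : mf_index -> mf_space -> 'rV[R]_n;
  mf_inv : mf_index -> 'rV[R]_n -> mf_space;
  mf_cover : forall x, exists i, mf_dom i x;
  mf_dom_open : forall i, open (mf_dom i);
  mf_img_open : forall i, open (mf_chart i @` mf_dom i);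
  mf_chartK : forall i x, mf_dom i x -> mf_inv i (mf_chart i x) = x;
  mf_chart_cont : forall i, {within mf_dom i, continuous (mf_chart i)};
  mf_inv_cont :
    forall i, {within mf_chart i @` mf_dom i, continuous (mf_inv i)};
  mf_trans_smooth : forall i j,
    smooth_on (mf_chart i @` (mf_dom i `&` mf_dom j)) (mf_chart j \o mf_inv i);
  mf_trans_oriented : forall i j x,
    (mf_chart i @` (mf_dom i `&` mf_dom j)) x ->
    0 < \det ('J (mf_chart j \o mf_inv i) x)
}.

Definition chart_img (R : realType) (n : nat) (M : oriented_manifold R n)
    (i : mf_index M) : set 'rV[R]_n := mf_chart i @` mf_dom i.
Arguments chart_img {R n} M i.

(* Components of a W-valued k-form in every chart: [F i x v] is the value, at
   the point of coordinates x in the chart i, on the k tangent vectors given by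
   the rows of v. *)
Definition dform (R : realType) (n : nat) (M : oriented_manifold R n) (k : nat)
    (W : Type) : Type :=
  mf_index M -> 'rV[R]_n -> 'M[R]_(k, n) -> W.

Section Forms.
Variables (R : realType) (n : nat) (M : oriented_manifold R n).

Definition multilinear_rows (k : nat) (W : lmodType R)
    (f : 'M[R]_(k, n) -> W) : Prop :=
  forall (i : 'I_k) (a b : R) (A B C : 'M[R]_(k, n)),
    row i A = a *: row i B + b *: row i C ->
    row' i B = row' i A -> row' i C = row' i A ->
    f A = a *: f B + b *: f C.

Definition alternating_rows (k : nat) (W : lmodType R)
    (f : 'M[R]_(k, n) -> W) : Prop :=
  forall (i j : 'I_k) (A : 'M[R]_(k, n)),
    i != j -> row i A = row j A -> f A = 0.

Definition is_dform (k : nat) (W : normedModType R) (F : dform M k W) : Prop :=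
  [/\ forall i v, smooth_on (chart_img M i) (fun x => F i x v),
      forall i x, chart_img M i x -> multilinear_rows (F i x),
      forall i x, chart_img M i x -> alternating_rows (F i x)
    & forall i j x, (mf_chart i @` (mf_dom i `&` mf_dom j)) x ->
        let t := mf_chart j \o mf_inv i in
        forall v, F i x v = F j (t x) (v *m 'J t x)].

Definition eq_dform (k : nat) (W : Type) (F G : dform M k W) : Prop :=
  forall i x, chart_img M i x -> forall v, F i x v = G i x v.

(* Normalized, as [wedge] below, so that
   d lambda (u, v) = D_u (lambda v) - D_v (lambda u)
   for constant vector fields u, v. *)
Definition extd (k : nat) (W : normedModType R) (F : dform M k W) :
    dform M k.+1 W :=
  fun i x v => \sum_(j < k.+1)
    (-1) ^+ j *: 'D_(row j v) (fun y => F i y (row' j v)) x.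

(* The product b(lambda ^ nu) of a 1-form and a k-form of values in U and V
   along b : U -> V -> W. *)
Definition wedge (k : nat) (U V : Type) (W : lmodType R) (b : U -> V -> W)
    (lambda : dform M 1 U) (nu : dform M k V) : dform M k.+1 W :=
  fun i x v => \sum_(j < k.+1)
    (-1) ^+ j *: b (lambda i x (row j v)) (nu i x (row' j v)).

End Forms.

Inductive model := DeSitter | Minkowski | AntiDeSitter.

Section Algebras.
Variable R : realType.

Definition levi_civita (n : nat) (t : n.-tuple 'I_n) : R :=
  \det (\matrix_(i < n, j < n) (tnth t i == j)%:R).

Definition mink3 : 'M[R]_3 := diag_mx (\row_j (if j == 0 then -1 else 1)).

(* The metric on R^4 of signature (3,1) for s = 1 and (2,2) for s = -1. *)
Definition metric4 (s : R) : 'M[R]_(3 + 1) := block_mx mink3 0 0 s%:M.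

Definition lie (X Y : 'M[R]_(3 + 1)) : 'M[R]_(3 + 1) := X *m Y - Y *m X.

Definition so_defect (n : nat) (Q X : 'M[R]_n) : 'M[R]_n :=
  X^T *m Q + Q *m X.

Definition so_alg (Q : 'M[R]_(3 + 1)) : {vspace 'M[R]_(3 + 1)} :=
  lker (linfun (so_defect Q)).

(* so(2,1) semidirect R^{2,1} as affine endomorphisms of R^3: the matrices
   with blocks X v / 0 0 where X is in so(2,1). *)
Definition iso_defect (X : 'M[R]_(3 + 1)) : 'M[R]_(3 + 1) :=
  block_mx (so_defect mink3 (ulsubmx X)) 0 (dlsubmx X) (drsubmx X).

Definition iso_alg : {vspace 'M[R]_(3 + 1)} := lker (linfun iso_defect).

Lemma so_defect_linear n (Q : 'M[R]_n) : linear (so_defect Q).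
Proof.
move=> a X Y; rewrite /so_defect linearP /= mulmxDl mulmxDr scalerDr.
by rewrite -scalemxAl -scalemxAr addrACA.
Qed.

Lemma iso_defect_linear : linear iso_defect.
Proof.
move=> a X Y; rewrite /iso_defect.
have -> : ulsubmx (a *: X + Y) = a *: ulsubmx X + ulsubmx Y.
  by apply/matrixP => i j; rewrite !mxE.
have -> : dlsubmx (a *: X + Y) = a *: dlsubmx X + dlsubmx Y.
  by apply/matrixP => i j; rewrite !mxE.
have -> : drsubmx (a *: X + Y) = a *: drsubmx X + drsubmx Y.
  by apply/matrixP => i j; rewrite !mxE.
by rewrite so_defect_linear scale_block_mx add_block_mx scaler0 addr0.
Qed.

Lemma so_algE (Q X : 'M[R]_(3 + 1)) :
  (X \in so_alg Q) = (X^T *m Q + Q *m X == 0).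
Proof.
pose L := GRing.isLinear.Build _ _ _ _ _ (so_defect_linear Q).
pose f : {linear _ -> _} := HB.pack (so_defect Q) L.
by rewrite memv_ker -[so_defect Q]/(f : _ -> _) lfunE.
Qed.

Lemma iso_algE (X : 'M[R]_(3 + 1)) :
  (X \in iso_alg) =
  [&& so_defect mink3 (ulsubmx X) == 0, dlsubmx X == 0 & drsubmx X == 0].
Proof.
pose L := GRing.isLinear.Build _ _ _ _ _ iso_defect_linear.
pose f : {linear _ -> _} := HB.pack iso_defect L.
rewrite memv_ker -[iso_defect]/(f : _ -> _) lfunE /= /iso_defect.
apply/eqP/and3P => [E|[/eqP -> /eqP -> /eqP ->]]; last exact: block_mx0.
move: E; rewrite -[0 in RHS](block_mx0 _ 3 1 3 1) => /eq_block_mx[-> _ -> ->].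
by rewrite !eqxx.
Qed.

Definition g_alg (m : model) : {vspace 'M[R]_(3 + 1)} :=
  match m with
  | DeSitter => so_alg (metric4 1)
  | Minkowski => iso_alg
  | AntiDeSitter => so_alg (metric4 (-1))
  end.

Definition killing (g : {vspace 'M[R]_(3 + 1)}) (X Y : 'M[R]_(3 + 1)) : R :=
  \sum_(i < \dim g) coord (vbasis g) i (lie X (lie Y (vbasis g)`_i)).

(* The basepoint of G/H; for the affine group it is the origin of R^3. *)
Definition basepoint : 'cV[R]_(3 + 1) := col_mx 0 1%:M.

Definition in_h (m : model) (X : 'M[R]_(3 + 1)) : Prop :=
  X \in g_alg m /\ X *m basepoint = 0.

Definition in_p (m : model) (Y : 'M[R]_(3 + 1)) : Prop :=
  Y \in g_alg m /\
  match m with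
  | Minkowski => ulsubmx Y = 0
  | _ => forall X, in_h m X -> killing (g_alg m) X Y = 0
  end.

(* Hodge star on so(Q), identified with the bivectors of R^4 by
   X^{cd} = X^c_f Q^{fd}; the bit o chooses the orientation, and
   |det Q| = 1 for the metrics used here. *)
Definition hodge (Q : 'M[R]_(3 + 1)) (o : bool) (X : 'M[R]_(3 + 1)) :
    'M[R]_(3 + 1) :=
  (-1) ^+ o *: (invmx Q *m \matrix_(a, b)
    (2^-1 * \sum_c \sum_d
      levi_civita [tuple a; b; c; d] * (X *m invmx Q) c d)).

(* (Jmx a)^d_b = eps_{abc} eta^{cd}, where eta = mink3 is its own inverse. *)
Definition Jmx (a : 'I_3) : 'M[R]_(3 + 1) :=
  block_mx (\matrix_(d, b) \sum_c levi_civita [tuple a; b; c] * mink3 c d)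
           0 0 0.

Definition Pmx (a : 'I_3) : 'M[R]_(3 + 1) := block_mx 0 (delta_mx a 0) 0 0.

Definition JPbasis : (3 + 3).-tuple 'M[R]_(3 + 1) :=
  cat_tuple (mktuple Jmx) (mktuple Pmx).

Definition Jcoord (a : 'I_3) (X : 'M[R]_(3 + 1)) : R :=
  coord JPbasis (lshift 3 a) X.
Definition Pcoord (a : 'I_3) (X : 'M[R]_(3 + 1)) : R :=
  coord JPbasis (rshift 3 a) X.

Definition iso_star_form (X Y : 'M[R]_(3 + 1)) : R :=
  \sum_a \sum_b mink3 a b * (Jcoord a X * Pcoord b Y + Pcoord b X * Jcoord a Y).

(* tr(XY), with normalization c *)
Definition trf (m : model) (c : R) (X Y : 'M[R]_(3 + 1)) : R^o :=
  c * killing (g_alg m) X Y.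

(* tr(X *Y); the normalization s is independent of c and only used in the
   Minkowski case, where no Hodge star is available. *)
Definition trs (m : model) (c s : R) (o : bool) (X Y : 'M[R]_(3 + 1)) : R^o :=
  match m with
  | DeSitter => trf m c X (hodge (metric4 1) o Y)
  | Minkowski => s * iso_star_form X Y
  | AntiDeSitter => trf m c X (hodge (metric4 (-1)) o Y)
  end.

Definition beta_form (m : model) (c s : R) (o : bool) (mu : R)
    (X Y : 'M[R]_(3 + 1)) : R^o :=
  mu^-1 * trf m c X Y - trs m c s o X Y.

End Algebras.

Section Gravity.
Variables (R : realType) (m : model) (M : oriented_manifold R 3).
Implicit Types e omega A : dform M 1 'M[R]_(3 + 1).

Definition coframe e : Prop :=
  [/\ is_dform e,
      forall i x v, chart_img M i x -> in_p m (e i x v)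
    & forall i x, chart_img M i x ->
        forall Y, in_p m Y -> exists! v, e i x v = Y].

Definition covariant_d omega e : dform M 2 'M[R]_(3 + 1) :=
  extd e + wedge (@lie R) omega e.

Definition torsion_free_connection e omega : Prop :=
  [/\ is_dform omega,
      forall i x v, chart_img M i x -> in_h m (omega i x v)
    & eq_dform (covariant_d omega e) 0].

Definition curvature omega : dform M 2 'M[R]_(3 + 1) :=
  extd omega + 2^-1 *: wedge (@lie R) omega omega.

Definition tmg_integrand (c s : R) (o : bool) (mu : R) e omega :
    dform M 3 R^o :=
  - wedge (trs m c s o) e (curvature omega)
  - 6^-1 *: wedge (trs m c s o) e (wedge (@lie R) e e)
  + (2 * mu)^-1 *: (wedge (trf m c) omega (extd omega)
      + 3^-1 *: wedge (trf m c) omega (wedge (@lie R) omega omega)).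

Definition cs_integrand (b : 'M[R]_(3 + 1) -> 'M[R]_(3 + 1) -> R^o) A :
    dform M 3 R^o :=
  2^-1 *: (wedge b A (extd A) + 3^-1 *: wedge b A (wedge (@lie R) A A)).

(* The 2-forms obtained algebraically from omega and e by constant bilinear
   forms. *)
Definition boundary_form
    (b1 b2 b3 : {bilinear 'M[R]_(3 + 1) -> 'M[R]_(3 + 1) -> R^o})
    omega e : dform M 2 R^o :=
  wedge (fun X Y => b1 X Y) omega omega + wedge (fun X Y => b2 X Y) omega e
  + wedge (fun X Y => b3 X Y) e e.

End Gravity.

(* Main.v *)
(* Split beta = tr/mu - tr*.  The form tr vanishes on h x p and tr* vanishes on
   h x h and p x p, which kills most terms of beta(A ^ (dA + [A,A]/3)) for
   A = omega + e.  By invariance the tr part that remains is the Chern-Simons form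
   of omega plus tr(e ^ d_omega e), and the latter is zero; the tr* part is
   tr*(omega ^ de) + tr*(e ^ d omega) + tr*(e ^ [omega,omega]) + tr*(e ^ [e,e])/3.
   Exchanging tr*(omega ^ de) for tr*(e ^ d omega) gives the gravitational action,
   at the cost of the boundary term -(1/2) d tr*(omega ^ e). *)
Require Import Defs.
From HB Require Import structures.
From mathcomp Require Import all_boot all_order all_algebra.
From mathcomp Require Import ring lra.
From mathcomp Require Import all_classical all_reals all_analysis.

Import Order.TTheory GRing.Theory Num.Theory.
Import numFieldNormedType.Exports.

Local Open Scope classical_set_scope.
Local Open Scope ring_scope.

Set Implicit Arguments.
Unset Strict Implicit.
Unset Printing Implicit Defensive.

(** * Calculus of bilinear expressions *)

(** The rules for tr and tr* must hold for three algebras at once, and for a Killing form defined as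
    a trace over an unspecified basis. One matrix family [gmx s] with [s] = 1, 0, -1 absorbs the
    case distinction: in its coordinates tr is [c * (4 * (dotJ - s * dotP))], tr* is a multiple of
    [dotJP], and invariance and vanishing become polynomial identities. These rules apply to d omega
    and de only because the two 2-forms again take values in h and p: the derivative of a function
    with values in a linear subspace stays in it. The comparison is then algebra at a single point
    of a chart. The analysis reduces to additivity of d, the Leibniz rule for tr*(omega ^ e), and
    smoothness of that 2-form. The constant of the boundary term arises because the Chern-Simons
    form contains tr*(e ^ d omega) and tr*(omega ^ de) with coefficient -1/2 each, whereas the
    gravitational action contains the first alone, with coefficient -1. *)

Lemma bilinear_mx_continuous (R : realType) (W : normedModType R)
    (m n m' n' : nat) (b : {bilinear 'M[R]_(m, n) -> 'M[R]_(m', n') -> W}) :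
  continuous (fun p => b p.1 p.2).
Proof.
(* Expanding both arguments over the elementary matrices turns [b] into a finite sum of products of
   entries. *)
have -> : (fun p => b p.1 p.2) = fun p : 'M[R]_(m, n) * 'M[R]_(m', n') =>
    \sum_i \sum_j \sum_k \sum_l
      p.1 i j *: (p.2 k l *: b (delta_mx i j) (delta_mx k l)).
  apply/funext => p.
  rewrite {1}[p.1]matrix_sum_delta linear_sumlz; apply: eq_bigr => i _.
  rewrite linear_sumlz; apply: eq_bigr => j _.
  rewrite linearZl_LR {1}[p.2]matrix_sum_delta linear_sumr /= scaler_sumr.
  apply: eq_bigr => k _; rewrite linear_sumr /= scaler_sumr.
  by apply: eq_bigr => l _; rewrite linearZr_LR.
move=> p.
do 4 (apply: cvg_big => [x0 x|]; [exact: add_continuous|move=> ? _]); apply: cvgZ.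
  apply: (@cvg_comp _ _ _ fst (fun A : 'M[R]_(m, n) => A _ _)); first exact: cvg_fst.
  exact: coord_continuous.
apply: cvgZ; last exact: cvg_cst.
apply: (@cvg_comp _ _ _ snd (fun A : 'M[R]_(m', n') => A _ _)); first exact: cvg_snd.
exact: coord_continuous.
Qed.

Section BilinearLeibniz.
Variables (R : realType) (V W : normedModType R) (m n m' n' : nat).
Variable b : {bilinear 'M[R]_(m, n) -> 'M[R]_(m', n') -> W}.
Variables (f : V -> 'M[R]_(m, n)) (g : V -> 'M[R]_(m', n')) (x : V).
Hypotheses (df : differentiable f x) (dg : differentiable g x).

Lemma differentiable_bilin_comp : differentiable (fun y => b (f y) (g y)) x.
Proof.
apply: (@differentiable_comp _ _ _ _ (fun y => (f y, g y)) (fun p => b p.1 p.2)).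
  exact: differentiable_pair.
apply: differentiable_bilin; exact: bilinear_mx_continuous.
Qed.

Lemma derive_bilin v :
  'D_v (fun y => b (f y) (g y)) x = b ('D_v f x) (g x) + b (f x) ('D_v g x).
Proof.
rewrite !deriveE //; last exact: differentiable_bilin_comp.
rewrite -[X in 'd X x]/((fun p => b p.1 p.2) \o (fun y => (f y, g y))).
rewrite diff_comp; last first.
- apply: differentiable_bilin; exact: bilinear_mx_continuous.
- exact: differentiable_pair.
rewrite diff_bilin; last exact: bilinear_mx_continuous.
by rewrite /= diff_pair //= addrC.
Qed.

End BilinearLeibniz.

(** The differential of [f] serves for [g]: the first-order expansion at [x] depends only on the
    germ, and [diff_unique] identifies its linear part. *)
Lemma near_eq_differentiable (R : realType) (V W : normedModType R)
    (f g : V -> W) x :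
  {near x, f =1 g} -> differentiable f x -> differentiable g x.
Proof.
move=> fg df; have [cdf /eqaddoP dfo] := (diff_locallyP x f).1 df.
have dgo : g \o shift x = cst (g x) + 'd f x +o_ 0 id.
  apply/eqaddoP => eps eps0; have := dfo eps eps0.
  have : \forall h \near (0 : V), f (h + x) = g (h + x).
    move: fg; rewrite (near_shift 0) /=.
    by apply: filterS => h /=; rewrite subr0.
  rewrite -!(nbhs_singleton fg).
  by apply: filterS2 => h /= fgh; rewrite /= !fctE /= fgh.
by apply/diff_locallyP; rewrite (diff_unique cdf dgo).
Qed.

(** * Stability of C^k regularity on an open set *)

Section CkOn.
Variables (R : realType) (V : normedModType R) (U : set V).
Hypothesis oU : open U.

(** As [U] is open, equality on [U] is equality of germs at its points, so it passes to all the
    derivatives that [Ck_on] inspects. *)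
Lemma Ck_on_eq (W : normedModType R) k (f g : V -> W) :
  (forall x, U x -> f x = g x) -> Ck_on k U f -> Ck_on k U g.
Proof.
have near_eq f' g' x : (forall y, U y -> f' y = g' y :> W) -> U x ->
    {near x, f' =1 g'}.
  by move=> fg Ux; near=> y; apply: fg; near: y; exact: open_nbhs_nbhs.
elim: k f g => [|k IHk] f g fg /=.
  move=> cf x Ux; have := cf x Ux; rewrite /prop_for/continuous_at -(fg x Ux).
  by apply: cvg_trans; apply: near_eq_cvg; exact: near_eq.
move=> [df Ckf]; split=> [x Ux|v].
  have nfg := near_eq _ _ x fg Ux.
  exact: near_eq_differentiable nfg (df x Ux).
apply: IHk (Ckf v) => x Ux.
exact/near_eq_derive/near_eq.
Unshelve. all: by end_near. Qed.

Lemma Ck_onS (W : normedModType R) k (f : V -> W) : Ck_on k.+1 U f -> Ck_on k U f.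
Proof.
elim: k f => [|k IHk] f [df Ckf].
  by move=> x Ux; apply: differentiable_continuous; exact: df.
by split=> // v; apply/IHk/Ckf.
Qed.

Lemma Ck_on_comb (W : normedModType R) k a (f g : V -> W) :
  Ck_on k U f -> Ck_on k U g -> Ck_on k U (a *: f + g).
Proof.
elim: k f g => [|k IHk] f g.
  move=> cf cg x Ux; apply: continuousD; last exact: cg.
  by apply: continuousZl_tmp; exact: cf.
move=> [df Ckf] [dg Ckg]; split=> [x Ux|v].
  by apply: differentiableD; [exact/differentiableZ/df|exact: dg].
apply: Ck_on_eq (IHk _ _ (Ckf v) (Ckg v)) => x Ux.
have dfx : derivable f x v by exact/diff_derivable/df.
have dgx : derivable g x v by exact/diff_derivable/dg.
by rewrite deriveD ?deriveZ //; exact: derivableZ.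
Qed.

(** By the Leibniz rule each derivative is a sum of two expressions of the same kind; in each of
    them the undifferentiated factor is lowered by one order with [Ck_onS]. *)
Lemma Ck_on_bilin (W : normedModType R) (m n m' n' : nat) k
    (b : {bilinear 'M[R]_(m, n) -> 'M[R]_(m', n') -> W}) f g :
  Ck_on k U f -> Ck_on k U g -> Ck_on k U (fun y => b (f y) (g y)).
Proof.
elim: k f g => [|k IHk] f g.
  move=> cf cg x Ux.
  apply: (@continuous2_cvg _ _ _ _ _ _ f g (fun X Y => b X Y) (f x) (g x));
    [|exact: cf|exact: cg].
  exact: (@bilinear_mx_continuous _ _ _ _ _ _ b (f x, g x)).
move=> Ckf Ckg; have [df Ckdf] := Ckf; have [dg Ckdg] := Ckg; split=> [x Ux|v].
  by apply: differentiable_bilin_comp; [exact: df|exact: dg].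
apply: (@Ck_on_eq _ _
    (1 *: (fun y => b ('D_v f y) (g y)) + (fun y => b (f y) ('D_v g y)))).
  by move=> x Ux; rewrite derive_bilin ?scale1r; [|exact: df|exact: dg].
apply: Ck_on_comb; apply: IHk; [exact: Ckdf| |exact: Ck_onS|exact: Ckdg].
exact: Ck_onS Ckg.
Qed.

End CkOn.

Section LinearDerive.
Variables (R : realType) (m n : nat) (W : normedModType R).
Variable L : {linear 'M[R]_(m, n) -> W}.

Lemma linear_mx_continuous : continuous L.
Proof.
have -> : L = (fun A => \sum_i \sum_j A i j *: L (delta_mx i j)) :> (_ -> _).
  apply/funext => A; rewrite {1}[A]matrix_sum_delta linear_sum.
  apply: eq_bigr => i _; rewrite linear_sum.
  by apply: eq_bigr => j _; rewrite linearZ_LR.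
apply: continuous_big => [|k _]; first exact: add_continuous.
apply: continuous_big => [|l _]; first exact: add_continuous.
by move=> A; apply: continuousZr_tmp; exact: coord_continuous.
Qed.

Lemma derive_linear (V : normedModType R) (f : V -> 'M[R]_(m, n)) x v :
  differentiable f x -> 'D_v (fun y => L (f y)) x = L ('D_v f x).
Proof.
move=> df; have dL : differentiable L (f x).
  by apply: linear_differentiable; exact: linear_mx_continuous.
rewrite !deriveE //; last exact: (@differentiable_comp _ _ _ _ f L).
rewrite -[X in 'd X x]/(L \o f) diff_comp //=.
by rewrite diff_lin //; exact: linear_mx_continuous.
Qed.

End LinearDerive.

(** * The three Lie algebras in coordinates *)

(* The left-hand side is the trace of T on g; E spans g with coordinates f. *)
Lemma trace_dual_family (K : fieldType) (V : vectType K) (g : {vspace V})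
    (n : nat) (E : 'I_n -> V) (f : 'I_n -> {linear V -> K^o})
    (T : {linear V -> V}) :
  (forall k, E k \in g) -> (forall X, X \in g -> T X \in g) ->
  (forall X, X \in g -> X = \sum_k f k X *: E k) ->
  \sum_(i < \dim g) coord (vbasis g) i (T (vbasis g)`_i) = \sum_k f k (T (E k)).
Proof.
move=> Eg Tg spanE.
(* As for tr(AB) = tr(BA), both sides equal one double sum, obtained by expanding [T (E k)] in the
   basis and the basis vectors in [E]. *)
have -> : \sum_k f k (T (E k)) = \sum_k \sum_(i < \dim g)
    coord (vbasis g) i (T (E k)) * f k (vbasis g)`_i.
  apply: eq_bigr => k _.
  rewrite {1}(coord_vbasis (Tg _ (Eg k))) linear_sum.
  by apply: eq_bigr => i _; rewrite linearZ_LR.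
rewrite exchange_big; apply: eq_bigr => i _ /=.
have big : (vbasis g)`_i \in g by rewrite vbasis_mem ?mem_nth ?size_tuple.
rewrite {1}(spanE _ big) !linear_sum.
by apply: eq_bigr => k _; rewrite !linearZ_LR /= mulrC.
Qed.

Definition mx4 (R : realType) (l : seq (seq R)) : 'M[R]_(3 + 1) :=
  \matrix_(i, j) nth 0 (nth [::] l i) j.

(* The element sum_a (x_a J_a + x_(3+a) P_a) of the Lie algebra.  The sign s is
   that of the fourth metric entry for so(3,1) and so(2,2), and s = 0 gives the
   Poincare algebra, which puts the three models in one formula. *)
Definition gmx (R : realType) (s : R) (x : nat -> R) : 'M[R]_(3 + 1) :=
  mx4 [:: [:: 0; x 2%N; - x 1%N; x 3%N]; [:: x 2%N; 0; - x 0%N; x 4%N];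
          [:: - x 1%N; x 0%N; 0; x 5%N];
          [:: s * x 3%N; - (s * x 4%N); - (s * x 5%N); 0]].

Local Notation o4 k := (@Ordinal 4 k isT).

Ltac case_ord4 := case=> [[|[|[|[|//]]]] ?].

Section Coordinates.
Variable R : realType.
Implicit Types (s : R) (x y : nat -> R) (X Y : 'M[R]_(3 + 1)).

Lemma metric4E s : metric4 s =
  mx4 [:: [:: -1; 0; 0; 0]; [:: 0; 1; 0; 0]; [:: 0; 0; 1; 0]; [:: 0; 0; 0; s]].
Proof.
apply/matrixP => i j.
case: (split_ordP i) => i' ->; case: (split_ordP j) => j' ->.
- rewrite block_mxEul !mxE; case: i' j' => [[|[|[|//]]] ?] [[|[|[|//]]] ?] //.
- rewrite block_mxEur !mxE; case: i' j' => [[|[|[|//]]] ?] [[|//] ?] //.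
- rewrite block_mxEdl !mxE; case: i' j' => [[|//] ?] [[|[|[|//]]] ?] //.
- rewrite block_mxEdr !mxE; case: i' j' => [[|//] ?] [[|//] ?] //.
Qed.

(** The entries read off avoid the fourth row of [gmx s x], which carries no information when [s] is
    0. *)
Definition gcoord_seq X : seq R :=
  [:: X (o4 2) (o4 1); - X (o4 0) (o4 2); X (o4 0) (o4 1);
      X (o4 0) (o4 3); X (o4 1) (o4 3); X (o4 2) (o4 3)].

Definition gcoord (k : nat) X : R^o := nth 0 (gcoord_seq X) k.

Lemma gcoord_linear k : linear (gcoord k).
Proof.
move=> a X Y; rewrite /gcoord /gcoord_seq /= !mxE.
case: k => [|[|[|[|[|[|k]]]]]] //=; rewrite ?nth_nil ?scaler0 ?addr0 //.
by rewrite scalerN opprD.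
Qed.

HB.instance Definition _ k :=
  GRing.isLinear.Build R 'M[R]_(3 + 1) R^o _ (gcoord k) (gcoord_linear k).

Lemma gcoord_gmx s x k : (k < 6)%N -> gcoord k (gmx s x) = x k.
Proof.
by case: k => [|[|[|[|[|[|k]]]]]] //= _; rewrite /gcoord /= !mxE /= ?opprK.
Qed.

(** The structure constants in the basis J_a, P_a. Only [P, P] carries [s], so the translations
    commute for [s] = 0. *)
Definition gbracket s x y (k : nat) : R := nth 0
  [:: x 2%N * y 1%N - x 1%N * y 2%N + s * (x 4%N * y 5%N - x 5%N * y 4%N);
      x 2%N * y 0%N - x 0%N * y 2%N + s * (x 3%N * y 5%N - x 5%N * y 3%N);
      x 0%N * y 1%N - x 1%N * y 0%N + s * (x 4%N * y 3%N - x 3%N * y 4%N);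
      x 2%N * y 4%N - x 1%N * y 5%N - x 4%N * y 2%N + x 5%N * y 1%N;
      x 2%N * y 3%N - x 0%N * y 5%N - x 3%N * y 2%N + x 5%N * y 0%N;
      x 0%N * y 4%N - x 1%N * y 3%N + x 3%N * y 1%N - x 4%N * y 0%N] k.

Lemma lie_gmx s x y : lie (gmx s x) (gmx s y) = gmx s (gbracket s x y).
Proof.
apply/matrixP; case_ord4; case_ord4; rewrite !mxE !big_ord_recl !big_ord0 !mxE /=;
  rewrite /gbracket /=; ring.
Qed.

Definition curvature_sign (m : model) : R :=
  match m with DeSitter => 1 | Minkowski => 0 | AntiDeSitter => -1 end.

(** Entries indexed by [nat] do not mention the bound proofs of ordinals, so equal entries become
    identical atoms for [lra]. *)
Lemma matrix_nat_entries X : exists x : nat -> nat -> R, X = \matrix_(i, j) x i j.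
Proof.
exists (fun i j => X (inord i) (inord j)).
by apply/matrixP => i j; rewrite mxE !inord_val.
Qed.

Lemma so_algP s X : s * s = 1 ->
  reflect (X = gmx s (fun k => gcoord k X)) (X \in so_alg (metric4 s)).
Proof.
move=> ss; rewrite so_algE metric4E; apply: (iffP eqP) => [|->]; last first.
  move: (fun k => gcoord k X) => x.
  apply/matrixP; case_ord4; case_ord4; rewrite !mxE !big_ord_recl !big_ord0 !mxE /=;
    rewrite ?(mulrA s s) ?(mulrN s) ?(mulrA s s) ?ss; ring: ss.
have [x ->] := matrix_nat_entries X => /matrixP E.
pose o k (hk : (k < 4)%N) : 'I_(3 + 1) := Ordinal hk.
move: (E (o 0%N isT) (o 0%N isT)) (E (o 1%N isT) (o 1%N isT))
  (E (o 2%N isT) (o 2%N isT)) (E (o 3%N isT) (o 3%N isT))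
  (E (o 0%N isT) (o 1%N isT)) (E (o 0%N isT) (o 2%N isT))
  (E (o 1%N isT) (o 2%N isT)) (E (o 0%N isT) (o 3%N isT))
  (E (o 1%N isT) (o 3%N isT)) (E (o 2%N isT) (o 3%N isT)).
rewrite !mxE !big_ord_recl !big_ord0 !mxE /=.
move=> E00 E11 E22 E33 E01 E02 E12 E03 E13 E23.
(* The defect equations in the last column only give [s] times the fourth row of the matrix; a
   second factor [s] recovers the row because [s * s = 1]. *)
have scale_s u v : u = v -> s * u = s * v by move->.
have x30 : x 3%N 0%N = s * x 0%N 3%N.
  by rewrite -[LHS]mul1r -ss; move: (scale_s _ _ E03); rewrite /bump /=; lra.
have x31 : x 3%N 1%N = - (s * x 1%N 3%N).
  by rewrite -[LHS]mul1r -ss; move: (scale_s _ _ E13); rewrite /bump /=; lra.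
have x32 : x 3%N 2%N = - (s * x 2%N 3%N).
  by rewrite -[LHS]mul1r -ss; move: (scale_s _ _ E23); rewrite /bump /=; lra.
have x33 : x 3%N 3%N = 0.
  by rewrite -[LHS]mul1r -ss; move: (scale_s _ _ E33); rewrite /bump /=; lra.
apply/matrixP; case_ord4; case_ord4;
  rewrite !mxE /= /gcoord /= ?mxE /= ?x30 ?x31 ?x32 ?x33 //; lra.
Qed.

End Coordinates.

Section LieAlgebra.
Variable R : realType.
Implicit Types (s : R) (x y : nat -> R) (X Y : 'M[R]_(3 + 1)) (m : model).

Lemma iso_algP X : reflect (X = gmx 0 (fun k => gcoord k X)) (X \in iso_alg R).
Proof.
rewrite iso_algE; apply: (iffP and3P) => [[]|->]; last first.
  move: (fun k => gcoord k X) => x.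
  split; apply/eqP/matrixP; last 2 first.
  - by case=> [[|//] ?] [[|[|[|//]]] ?]; rewrite !mxE /= ?mul0r ?oppr0.
  - by case=> [[|//] ?] [[|//] ?]; rewrite !mxE.
  by case=> [[|[|[|//]]] ?] [[|[|[|//]]] ?];
    rewrite !mxE !big_ord_recl !big_ord0 !mxE /=; ring.
have [x ->] := matrix_nat_entries X.
move=> /eqP/matrixP E /eqP/matrixP Ed /eqP/matrixP Er.
pose o k (hk : (k < 3)%N) : 'I_3 := Ordinal hk.
move: (E (o 0%N isT) (o 0%N isT)) (E (o 1%N isT) (o 1%N isT))
  (E (o 2%N isT) (o 2%N isT)) (E (o 0%N isT) (o 1%N isT))
  (E (o 0%N isT) (o 2%N isT)) (E (o 1%N isT) (o 2%N isT))
  (Ed 0 (o 0%N isT)) (Ed 0 (o 1%N isT)) (Ed 0 (o 2%N isT)) (Er 0 0).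
rewrite !mxE !big_ord_recl !big_ord0 !mxE /=.
rewrite /bump /= => E00 E11 E22 E01 E02 E12 E03 E13 E23 E33.
apply/matrixP; case_ord4; case_ord4; rewrite !mxE /= /gcoord /= ?mxE /=;
  rewrite ?E03 ?E13 ?E23 ?E33 ?mul0r ?oppr0 //; lra.
Qed.

Lemma g_algP m X :
  reflect (X = gmx (curvature_sign R m) (fun k => gcoord k X)) (X \in g_alg R m).
Proof.
case: m => /=; [apply: so_algP|exact: iso_algP|apply: so_algP].
- exact: mulr1.
- by rewrite mulrNN mulr1.
Qed.

Lemma gmx_ext s x y : (forall k, (k < 6)%N -> x k = y k) -> gmx s x = gmx s y.
Proof. by move=> xy; rewrite /gmx !xy. Qed.

Lemma gmx_in_g m x : gmx (curvature_sign R m) x \in g_alg R m.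
Proof. by apply/g_algP; apply: gmx_ext => k k6; rewrite gcoord_gmx. Qed.

Lemma gmx_sum s x :
  gmx s x = \sum_(k < 6) x k *: gmx s (fun l => (l == k)%:R).
Proof.
rewrite !big_ord_recl big_ord0 /=.
apply/matrixP; case_ord4; case_ord4; rewrite !mxE /=; ring.
Qed.

Lemma lie_g_alg m X Y :
  X \in g_alg R m -> Y \in g_alg R m -> lie X Y \in g_alg R m.
Proof. by move=> /g_algP -> /g_algP ->; rewrite lie_gmx gmx_in_g. Qed.

Lemma lie_mxC X Y : lie X Y = - lie Y X.
Proof. by rewrite /lie opprB. Qed.

Lemma lie_linear X : linear (lie X).
Proof.
move=> a Y Z; rewrite /lie mulmxDr mulmxDl -scalemxAr -scalemxAl.
by rewrite scalerBr opprD addrACA.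
Qed.

HB.instance Definition _ X :=
  GRing.isLinear.Build R 'M[R]_(3 + 1) 'M[R]_(3 + 1) _ (lie X) (lie_linear X).

Lemma lie_bilinear :
  bilinear_for (GRing.Scale.Law.clone _ _ *:%R _) (GRing.Scale.Law.clone _ _ *:%R _)
    (@lie R).
Proof.
split=> [Y|X] a Z T /=; last exact: linearP.
by rewrite lie_mxC linearP [lie Z Y]lie_mxC [lie T Y]lie_mxC scalerN opprD.
Qed.

HB.instance Definition _ := bilinear_isBilinear.Build R _ _ 'M[R]_(3 + 1) _ _ (@lie R)
  lie_bilinear.

(** With the metric diag(-1, 1, 1): the products of the J parts and of the P parts, and the
    symmetric pairing of J parts with P parts. *)
Definition dotJ x y : R := x 1%N * y 1%N + x 2%N * y 2%N - x 0%N * y 0%N.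
Definition dotP x y : R := x 4%N * y 4%N + x 5%N * y 5%N - x 3%N * y 3%N.
Definition dotJP x y : R := (x 1%N * y 4%N + x 2%N * y 5%N - x 0%N * y 3%N)
  + (x 4%N * y 1%N + x 5%N * y 2%N - x 3%N * y 0%N).

(** [trace_dual_family] moves the trace from [vbasis] to the basis J_a, P_a, where the bracket is
    explicit. The factor 4 is 2 + 2: an element of h acts on both h and p as the vector
    representation, whose trace form is twice the metric. *)
Lemma killing_gmx m x y :
  killing (g_alg R m) (gmx (curvature_sign R m) x) (gmx (curvature_sign R m) y) =
  4 * (dotJ x y - curvature_sign R m * dotP x y).
Proof.
set s := curvature_sign R m.
pose E (k : 'I_6) := gmx s (fun l => (l == k)%:R).
pose f (k : 'I_6) : {linear 'M[R]_(3 + 1) -> R^o} := gcoord k.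
have Eg k : E k \in g_alg R m by exact: gmx_in_g.
have Tg X : X \in g_alg R m -> (lie (gmx s x) \o lie (gmx s y)) X \in g_alg R m.
  by move=> Xg; rewrite /= !lie_g_alg ?gmx_in_g.
have Esp X : X \in g_alg R m -> X = \sum_k f k X *: E k.
  by move=> /g_algP {1}->; rewrite gmx_sum.
rewrite /killing (trace_dual_family Eg Tg Esp) /=.
rewrite !big_ord_recl big_ord0 /= /E !lie_gmx !gcoord_gmx //.
rewrite /gbracket /dotJ /dotP /=; ring.
Qed.

End LieAlgebra.

(** * The Levi-Civita symbol, the Hodge star and the invariant forms *)

(** Laplace expansion along the first row, on integer entries indexed by [nat], so that [vm_compute]
    evaluates every value of the Levi-Civita symbol. *)
Fixpoint laplace_det (n : nat) (f : nat -> nat -> int) : int :=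
  if n is n'.+1 then foldr (fun j d =>
    f 0%N j * ((-1) ^+ j * laplace_det n' (fun i k => f i.+1 (bump j k))) + d)
    0 (iota 0 n)
  else 1.

Lemma laplace_detE n (f : nat -> nat -> int) :
  \det (\matrix_(i < n, j < n) f i j) = laplace_det n f.
Proof.
elim: n f => [|n IHn] f; first exact: det_mx00.
rewrite (expand_det_row _ ord0).
transitivity (\sum_(j <- iota 0 n.+1)
    f 0%N j * ((-1) ^+ j * laplace_det n (fun i k => f i.+1 (bump j k)))).
  have -> : iota 0 n.+1 = index_iota 0 n.+1 by rewrite /index_iota subn0.
  rewrite big_mkord; apply: eq_bigr => j _.
  rewrite mxE /cofactor add0n -IHn; congr (_ * (_ * \det _)).
  by apply/matrixP => i k; rewrite !mxE.
by rewrite unlock.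
Qed.

Lemma levi_civitaE (R : realType) n (t : n.-tuple 'I_n) :
  levi_civita R t =
  (laplace_det n (fun i j => (nth 0%N (map val t) i == j)%:R))%:~R.
Proof.
rewrite -laplace_detE -(det_map_mx intr); congr (\det _).
apply/matrixP => i j; rewrite !mxE (tnth_nth j) (nth_map j) ?size_tuple //.
by rewrite rmorph_nat.
Qed.

Ltac eval_levi_civita :=
  rewrite ?levi_civitaE;
  repeat match goal with |- context [laplace_det ?n ?f] =>
    let z := eval vm_compute in (laplace_det n f) in
    rewrite (_ : laplace_det n f = z); [|by vm_compute]
  end.

Section JPBasis.
Variable R : realType.

Lemma Jmx_gmx (a : 'I_3) : Jmx R a = gmx 0 (fun l => (l == a)%:R).
Proof.
apply/matrixP => i j.
case: (split_ordP i) => i' ->; case: (split_ordP j) => j' ->.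
- rewrite block_mxEul !mxE !big_ord_recl big_ord0 !mxE.
  by case: a i' j' => [[|[|[|//]]] ?] [[|[|[|//]]] ?] [[|[|[|//]]] ?];
    eval_levi_civita; rewrite /=; ring.
- by rewrite block_mxEur !mxE; case: i' j' => [[|[|[|//]]] ?] [[|//] ?];
    case: a => [[|[|[|//]]] ?].
- rewrite block_mxEdl !mxE; case: i' j' => [[|//] ?] [[|[|[|//]]] ?];
    by rewrite /= ?mul0r ?oppr0.
- by rewrite block_mxEdr !mxE; case: i' j' => [[|//] ?] [[|//] ?].
Qed.

Lemma Pmx_gmx (a : 'I_3) : Pmx R a = gmx 0 (fun l => (l == (3 + a)%N)%:R).
Proof.
apply/matrixP => i j.
case: (split_ordP i) => i' ->; case: (split_ordP j) => j' ->.
- by rewrite block_mxEul !mxE; case: i' j' => [[|[|[|//]]] ?] [[|[|[|//]]] ?];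
    rewrite /= ?oppr0.
- by rewrite block_mxEur !mxE; case: i' j' => [[|[|[|//]]] ?] [[|//] ?];
    case: a => [[|[|[|//]]] ?].
- by rewrite block_mxEdl !mxE; case: i' j' => [[|//] ?] [[|[|[|//]]] ?];
    rewrite /= ?mul0r ?oppr0.
- by rewrite block_mxEdr !mxE; case: i' j' => [[|//] ?] [[|//] ?].
Qed.

Lemma JPbasis_nth k : (k < 6)%N -> (JPbasis R)`_k = gmx 0 (fun l => (l == k)%:R).
Proof.
move=> k6; rewrite nth_cat size_tuple; case: ltnP => [k3|k3].
  by rewrite -[k]/(nat_of_ord (Ordinal k3)) nth_mktuple Jmx_gmx.
have k3' : (k - 3 < 3)%N by rewrite ltn_subLR.
rewrite -[(k - 3)%N]/(nat_of_ord (Ordinal k3')) nth_mktuple Pmx_gmx /=.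
by apply: gmx_ext => l _; rewrite subnKC.
Qed.

Lemma gmx_sum_JP (x : nat -> R) : gmx 0 x = \sum_(k < 3 + 3) x k *: (JPbasis R)`_k.
Proof.
by rewrite gmx_sum; apply: eq_bigr => k _; rewrite JPbasis_nth //; exact: (ltn_ord k).
Qed.

Lemma JPbasis_free : free (JPbasis R).
Proof.
apply/(@freeP _ _ _ (JPbasis R)) => k.
(* [gmx] takes coordinates indexed by [nat], so the family [k] is extended by zero; [gcoord] then
   reads each coefficient back. *)
pose x (l : nat) : R := if (insub l : option 'I_(3 + 3)) is Some i then k i else 0.
have xk i : k i = x i by rewrite /x valK.
under eq_bigr do rewrite xk.
rewrite -gmx_sum_JP => x0 i; rewrite xk.
have i6 := ltn_ord i.
by rewrite -(gcoord_gmx 0 x i6) x0 linear0.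
Qed.

Lemma coord_JP (x : nat -> R) (k : 'I_(3 + 3)) : coord (JPbasis R) k (gmx 0 x) = x k.
Proof. by rewrite gmx_sum_JP coord_sum_free // JPbasis_free. Qed.

Lemma iso_star_form_gmx (x y : nat -> R) :
  iso_star_form (gmx 0 x) (gmx 0 y) = dotJP x y.
Proof.
rewrite /iso_star_form /Jcoord /Pcoord.
under eq_bigr do under eq_bigr do rewrite !coord_JP.
by rewrite !big_ord_recl !big_ord0 !mxE /= /bump /= /dotJP; ring.
Qed.

End JPBasis.

Section HodgeStar.
Variable R : realType.
Implicit Types (s : R) (x : nat -> R).

Lemma metric4_sqr s : s * s = 1 -> metric4 s *m metric4 s = 1%:M.
Proof.
move=> ss; rewrite metric4E.
by apply/matrixP; case_ord4; case_ord4; rewrite !mxE !big_ord_recl !big_ord0 !mxE /=;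
  rewrite ?ss; ring.
Qed.

Lemma invmx_metric4 s : s * s = 1 -> invmx (metric4 s) = metric4 s.
Proof.
move=> /metric4_sqr QQ; have [Qu _] := mulmx1_unit QQ.
by rewrite -[LHS]mulmx1 -QQ mulKmx.
Qed.

(** Up to the orientation sign, the star sends J_a to P_a and P_a to -s J_a, so its square is -s: -1
    on so(3,1) and +1 on so(2,2). *)
Definition star_coord s (o : bool) x (k : nat) : R :=
  (-1) ^+ o * nth 0 [:: - s * x 3%N; - s * x 4%N; - s * x 5%N; x 0%N; x 1%N; x 2%N] k.

Lemma hodge_gmx s o x : s * s = 1 ->
  hodge (metric4 s) o (gmx s x) = gmx s (star_coord s o x).
Proof.
move=> ss; rewrite /hodge invmx_metric4 // metric4E.
have -> : gmx s x *m mx4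
    [:: [:: -1; 0; 0; 0]; [:: 0; 1; 0; 0]; [:: 0; 0; 1; 0]; [:: 0; 0; 0; s]] =
  mx4 [:: [:: 0; x 2%N; - x 1%N; s * x 3%N]; [:: - x 2%N; 0; - x 0%N; s * x 4%N];
          [:: x 1%N; x 0%N; 0; s * x 5%N];
          [:: - (s * x 3%N); - (s * x 4%N); - (s * x 5%N); 0]].
  by apply/matrixP; case_ord4; case_ord4;
    rewrite !mxE !big_ord_recl !big_ord0 !mxE /=; ring.
(* [D] is the dual bivector with both indices lowered; the remaining product with the metric raises
   the first one and gives back an endomorphism. *)
set D := (X in _ *m X).
have -> : D = mx4
   [:: [:: 0; s * x 5%N; - (s * x 4%N); - x 0%N];
       [:: - (s * x 5%N); 0; s * x 3%N; x 1%N];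
       [:: s * x 4%N; - (s * x 3%N); 0; x 2%N]; [:: x 0%N; - x 1%N; - x 2%N; 0]].
  rewrite /D; apply/matrixP; case_ord4; case_ord4; rewrite !mxE;
    rewrite !big_ord_recl !big_ord0 !mxE /=; eval_levi_civita; by field.
apply/matrixP; case_ord4; case_ord4;
  rewrite !mxE !big_ord_recl !big_ord0 !mxE /= /star_coord /=; ring: ss.
Qed.

End HodgeStar.

(** Applying the cyclic rule twice and then symmetry gives the usual b([X, Y], Z) = b(X, [Y, Z]). *)
Definition invariant_form (R : realType) (m : model)
    (b : 'M[R]_(3 + 1) -> 'M[R]_(3 + 1) -> R^o) : Prop :=
  forall X Y Z, X \in g_alg R m -> Y \in g_alg R m -> Z \in g_alg R m ->
    b X Y = b Y X /\ b X (lie Y Z) = b Y (lie Z X).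

(** A range of vanishing coordinates describes both h (P coordinates zero) and p (J coordinates
    zero), so closure under differences and derivatives is proved once for the two. *)
Definition vanishing_coords (R : realType) (m : model) (i j : nat)
    (X : 'M[R]_(3 + 1)) : Prop :=
  X \in g_alg R m /\ forall k, (i <= k < j)%N -> gcoord k X = 0.

Local Notation h_part m := (vanishing_coords m 3 6).
Local Notation p_part m := (vanishing_coords m 0 3).

Section InvariantForms.
Variables (R : realType) (m : model).
Implicit Types (s : R) (x y : nat -> R) (X Y : 'M[R]_(3 + 1)).

Local Notation sg := (curvature_sign R m).

Lemma basepointE : basepoint R = \col_i (i == 3 :> nat)%:R.
Proof.
apply/matrixP => i j; rewrite ord1 [RHS]mxE; case: (split_ordP i) => i' ->.
  by rewrite col_mxEu mxE; case: i' => [[|[|[|//]]] ?].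
by rewrite col_mxEd mxE ord1.
Qed.

Lemma in_hP X : in_h m X <-> h_part m X.
Proof.
rewrite /in_h basepointE; split=> -[Xg X0]; split=> //; last first.
  move/g_algP: Xg => ->; apply/matrixP; case_ord4 => j;
  rewrite !mxE !big_ord_recl big_ord0 !mxE /= ?(X0 3%N, X0 4%N, X0 5%N) //;
  by rewrite ?mulr0 ?mul0r ?oppr0 ?addr0.
move/matrixP: X0; move/g_algP: Xg => ->; move: (fun k => gcoord k X) => x E.
move: (E (@Ordinal 4 0 isT) 0) (E (@Ordinal 4 1 isT) 0) (E (@Ordinal 4 2 isT) 0).
rewrite !mxE !big_ord_recl !big_ord0 !mxE /= !mulr0 !mulr1 !add0r !addr0 => x3 x4 x5.
by case=> [|[|[|[|[|[|k]]]]]] //= _; rewrite gcoord_gmx.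
Qed.

(** For the semisimple models, the Killing product with J_k is 4 or -4 times the coordinate [k], so
    orthogonality to h kills the J coordinates. For Minkowski they are entries of the upper left
    block. *)
Lemma in_pP X : in_p m X -> p_part m X.
Proof.
case=> Xg Xp; split=> //.
have dual : (forall Y, in_h m Y -> killing (g_alg R m) Y X = 0) ->
    forall k, (k < 3)%N -> gcoord k X = 0.
  move=> Xh k k3; pose d l : R := (l == k)%:R.
  have Eh : in_h m (gmx sg d).
    apply/in_hP; split=> [|l /andP[l3 l6]]; first exact: gmx_in_g.
    by rewrite gcoord_gmx // /d gtn_eqF // (leq_trans k3).
  have := Xh _ Eh; rewrite {1}(g_algP _ _ Xg) killing_gmx => /eqP.
  rewrite mulf_eq0 pnatr_eq0 /= /dotJ /dotP /d => /eqP.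
  by case: k k3 {d Eh} => [|[|[|//]]] _ /=; lra.
move: Xp dual; case: (m) => /= Xp dual; [exact: dual| |exact: dual].
move/matrixP: Xp => Xp.
have X0 i j (hi : (i < 4)%N) (hj : (j < 4)%N) : (i < 3)%N -> (j < 3)%N ->
    X (Ordinal hi) (Ordinal hj) = 0.
  move=> i3 j3; have := Xp (Ordinal i3) (Ordinal j3); rewrite !mxE => <-.
  by congr (X _ _); apply/val_inj.
by case=> [|[|[|//]]] _; rewrite /gcoord /= X0 ?oppr0.
Qed.

Lemma killing_bilinear (g : {vspace 'M[R]_(3 + 1)}) c :
  bilinear_for (GRing.Scale.Law.clone _ _ *:%R _) (GRing.Scale.Law.clone _ _ *:%R _)
    (fun X Y => c * killing g X Y : R^o).
Proof.
rewrite /killing; split=> [Y|X] a Z T /=; rewrite -[_ *: _ in RHS]mulrCA -mulrDr;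
  congr (c * _); rewrite mulr_sumr -big_split; apply: eq_bigr => i _ /=.
- by rewrite linearPl linearP.
- by rewrite linearPl !linearP.
Qed.

HB.instance Definition _ c := bilinear_isBilinear.Build R _ _ R^o _ _ (trf m c)
  (killing_bilinear (g_alg R m) c).

Lemma hodge_linear s o : linear (hodge (metric4 s) o).
Proof.
move=> a X Y; rewrite /hodge scalerA mulrC -scalerA -scalerDr; congr (_ *: _).
rewrite scalemxAr -mulmxDr; congr (_ *m _); apply/matrixP => i j; rewrite !mxE.
rewrite mulrCA -mulrDr; congr (_ * _).
rewrite mulr_sumr -big_split; apply: eq_bigr => k _ /=.
rewrite mulr_sumr -big_split; apply: eq_bigr => l _ /=.
by rewrite mulmxDl -scalemxAl !mxE mulrDr mulrCA.
Qed.

HB.instance Definition _ s o := GRing.isLinear.Build R 'M[R]_(3 + 1) 'M[R]_(3 + 1) _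
  (hodge (metric4 s) o) (hodge_linear s o).

Lemma iso_star_form_bilinear s :
  bilinear_for (GRing.Scale.Law.clone _ _ *:%R _) (GRing.Scale.Law.clone _ _ *:%R _)
    (fun X Y => s * iso_star_form X Y : R^o).
Proof.
rewrite /iso_star_form /Jcoord /Pcoord; split=> [Y|X] a Z T /=;
  rewrite -[_ *: _ in RHS]mulrCA -mulrDr; congr (s * _);
  rewrite mulr_sumr -big_split; apply: eq_bigr => i _ /=;
  rewrite mulr_sumr -big_split; apply: eq_bigr => j _ /=;
  rewrite !linearP /= /GRing.scale /=; ring.
Qed.

Lemma trs_bilinear c s o :
  bilinear_for (GRing.Scale.Law.clone _ _ *:%R _) (GRing.Scale.Law.clone _ _ *:%R _)
    (trs m c s o).
Proof.
have so_bilinear s' : bilinear_for (GRing.Scale.Law.clone _ _ *:%R _)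
    (GRing.Scale.Law.clone _ _ *:%R _)
    (fun X Y => trf m c X (hodge (metric4 s') o Y)).
  split=> [Y|X] a Z T /=; first by rewrite linearPl.
  by rewrite linearP linearPr.
move: so_bilinear; case: (m) => so_bilinear; [exact: so_bilinear| |exact: so_bilinear].
exact: iso_star_form_bilinear.
Qed.

HB.instance Definition _ c s o := bilinear_isBilinear.Build R _ _ R^o _ _ (trs m c s o)
  (trs_bilinear c s o).

Lemma trf_gmx c x y :
  trf m c (gmx sg x) (gmx sg y) = c * (4 * (dotJ x y - sg * dotP x y)).
Proof. by rewrite /trf killing_gmx. Qed.

(** In the Killing form both blocks acquire the same factor -s under the star: from *P_a = -s J_a in
    the J block, and from the weight -s of the P block. The three models thus share one pairing, and
    its scale does not affect invariance or vanishing. *)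
Lemma trs_gmx c s o : exists k, forall x y,
  trs m c s o (gmx sg x) (gmx sg y) = k * dotJP x y.
Proof.
exists (match m with Minkowski => s | _ => - (-1) ^+ o * (4 * c * sg) end) => x y.
rewrite /trs; case: m => /=; last 1 first.
- rewrite hodge_gmx ?mulrNN ?mulr1 // /trf (killing_gmx AntiDeSitter) /=.
  rewrite /dotJ /dotP /dotJP /star_coord /=; ring.
- rewrite hodge_gmx ?mulr1 // /trf (killing_gmx DeSitter) /=.
  rewrite /dotJ /dotP /dotJP /star_coord /=; ring.
- by rewrite iso_star_form_gmx.
Qed.

Lemma trf_invariant c : invariant_form m (trf (R:=R) m c).
Proof.
move=> X Y Z /g_algP -> /g_algP -> /g_algP ->.
by rewrite !lie_gmx !trf_gmx /dotJ /dotP /gbracket /=; split; ring.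
Qed.

Lemma trs_invariant c s o : invariant_form m (trs m c s o).
Proof.
have [k trsE] := trs_gmx c s o.
move=> X Y Z /g_algP -> /g_algP -> /g_algP ->.
by rewrite !lie_gmx !trsE /dotJP /gbracket /=; split; ring.
Qed.

Lemma trf_hp c X Y : h_part m X -> p_part m Y -> trf m c X Y = 0.
Proof.
move=> [Xg X0] [Yg Y0]; move/g_algP: Xg => ->; move/g_algP: Yg => ->.
rewrite trf_gmx /dotJ /dotP /=
  !(X0 3%N, X0 4%N, X0 5%N) ?(Y0 0%N, Y0 1%N, Y0 2%N) //; ring.
Qed.

Lemma trf_ph c X Y : p_part m X -> h_part m Y -> trf m c X Y = 0.
Proof.
move=> Xp Yh; have [-> _] := trf_invariant c Xp.1 Yh.1 Yh.1.
exact: trf_hp.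
Qed.

Lemma trs_hh c s o X Y : h_part m X -> h_part m Y -> trs m c s o X Y = 0.
Proof.
have [k trsE] := trs_gmx c s o.
move=> [Xg X0] [Yg Y0]; move/g_algP: Xg => ->; move/g_algP: Yg => ->.
rewrite trsE /dotJP /=
  !(X0 3%N, X0 4%N, X0 5%N) ?(Y0 3%N, Y0 4%N, Y0 5%N) //; ring.
Qed.

Lemma trs_pp c s o X Y : p_part m X -> p_part m Y -> trs m c s o X Y = 0.
Proof.
have [k trsE] := trs_gmx c s o.
move=> [Xg X0] [Yg Y0]; move/g_algP: Xg => ->; move/g_algP: Yg => ->.
rewrite trsE /dotJP /=
  !(X0 0%N, X0 1%N, X0 2%N) ?(Y0 0%N, Y0 1%N, Y0 2%N) //; ring.
Qed.

Lemma lie_hh X Y : h_part m X -> h_part m Y -> h_part m (lie X Y).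
Proof.
move=> [Xg X0] [Yg Y0]; split; first exact: lie_g_alg.
move/g_algP: Xg => ->; move/g_algP: Yg => ->; rewrite lie_gmx.
case=> [|[|[|[|[|[|k]]]]]] //= _; rewrite gcoord_gmx // /gbracket /=;
  by rewrite !(X0 3%N, X0 4%N, X0 5%N) ?(Y0 3%N, Y0 4%N, Y0 5%N) //; ring.
Qed.

Lemma lie_hp X Y : h_part m X -> p_part m Y -> p_part m (lie X Y).
Proof.
move=> [Xg X0] [Yg Y0]; split; first exact: lie_g_alg.
move/g_algP: Xg => ->; move/g_algP: Yg => ->; rewrite lie_gmx.
case=> [|[|[|k]]] //= _; rewrite gcoord_gmx // /gbracket /=;
  by rewrite !(X0 3%N, X0 4%N, X0 5%N) ?(Y0 0%N, Y0 1%N, Y0 2%N) //; ring.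
Qed.

Lemma lie_pp X Y : p_part m X -> p_part m Y -> h_part m (lie X Y).
Proof.
move=> [Xg X0] [Yg Y0]; split; first exact: lie_g_alg.
move/g_algP: Xg => ->; move/g_algP: Yg => ->; rewrite lie_gmx.
case=> [|[|[|[|[|[|k]]]]]] //= _; rewrite gcoord_gmx // /gbracket /=;
  by rewrite !(X0 0%N, X0 1%N, X0 2%N) ?(Y0 0%N, Y0 1%N, Y0 2%N) //; ring.
Qed.

End InvariantForms.

(** * Differential forms *)

Section Rows.
Variables (R : realType) (n : nat).

Lemma row_row' k (v : 'M[R]_(k.+1, n)) (j : 'I_k.+1) (l : 'I_k) :
  row l (row' j v) = row (lift j l) v.
Proof. by apply/rowP => c; rewrite !mxE. Qed.

Lemma row'_row2 (w : 'M[R]_(2, n)) : (row' 0 w = row 1 w) * (row' 1 w = row 0 w).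
Proof.
by split; apply/matrixP => i c; rewrite !mxE; congr (w _ _);
  apply/val_inj; rewrite /= ord1.
Qed.

Lemma row_row'3 (v : 'M[R]_(3, n)) :
  (row 0 (row' 0 v) = row 1 v) * (row 1 (row' 0 v) = row ord_max v) *
  (row 0 (row' 1 v) = row 0 v) * (row 1 (row' 1 v) = row ord_max v) *
  (row 0 (row' ord_max v) = row 0 v) * (row 1 (row' ord_max v) = row 1 v).
Proof. by do !split; rewrite row_row'; congr row; apply/val_inj. Qed.

End Rows.

Section FormExpansions.
Variables (R : realType) (n : nat) (M : oriented_manifold R n).
Variables (i : mf_index M) (x : 'rV[R]_n).

Lemma wedge11E (U V : Type) (W : lmodType R) (b : U -> V -> W)
    (lambda : dform M 1 U) (nu : dform M 1 V) y w :
  wedge b lambda nu i y w = b (lambda i y (row 0 w)) (nu i y (row 1 w)) -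
    b (lambda i y (row 1 w)) (nu i y (row 0 w)).
Proof.
rewrite /wedge !big_ord_recl big_ord0 (_ : lift _ _ = 1); last exact/val_inj.
by rewrite !row'_row2 expr0 expr1 scale1r scaleN1r addr0.
Qed.

Lemma wedge12E (U V : Type) (W : lmodType R) (b : U -> V -> W)
    (lambda : dform M 1 U) (nu : dform M 2 V) v :
  wedge b lambda nu i x v = b (lambda i x (row 0 v)) (nu i x (row' 0 v)) -
    b (lambda i x (row 1 v)) (nu i x (row' 1 v)) +
    b (lambda i x (row ord_max v)) (nu i x (row' ord_max v)).
Proof.
rewrite /wedge !big_ord_recl big_ord0.
rewrite (_ : lift _ (lift _ _) = ord_max); last exact/val_inj.
rewrite (_ : lift _ _ = 1); last exact/val_inj.
by rewrite expr0 expr1 sqrrN expr1n !scale1r scaleN1r addr0 addrA.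
Qed.

Lemma extd1E (W : normedModType R) (lambda : dform M 1 W) w :
  extd lambda i x w = 'D_(row 0 w) (fun y => lambda i y (row 1 w)) x -
    'D_(row 1 w) (fun y => lambda i y (row 0 w)) x.
Proof.
rewrite /extd !big_ord_recl big_ord0 (_ : lift _ _ = 1); last exact/val_inj.
by rewrite !row'_row2 expr0 expr1 scale1r scaleN1r addr0.
Qed.

Lemma extd2E (W : normedModType R) (nu : dform M 2 W) v :
  extd nu i x v = 'D_(row 0 v) (fun y => nu i y (row' 0 v)) x -
    'D_(row 1 v) (fun y => nu i y (row' 1 v)) x +
    'D_(row ord_max v) (fun y => nu i y (row' ord_max v)) x.
Proof.
rewrite /extd !big_ord_recl big_ord0.
rewrite (_ : lift _ (lift _ _) = ord_max); last exact/val_inj.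
rewrite (_ : lift _ _ = 1); last exact/val_inj.
by rewrite expr0 expr1 sqrrN expr1n !scale1r scaleN1r addr0 addrA.
Qed.

Lemma extdD (W : normedModType R) (lambda mu : dform M 1 W) w :
  (forall v, differentiable (fun y => lambda i y v) x) ->
  (forall v, differentiable (fun y => mu i y v) x) ->
  extd (lambda + mu) i x w = (extd lambda + extd mu) i x w.
Proof.
move=> dl dm; rewrite ![in RHS]fctE !extd1E.
have dE u v : 'D_u (fun y => (lambda + mu) i y v) x =
    'D_u (fun y => lambda i y v) x + 'D_u (fun y => mu i y v) x.
  by rewrite -deriveD //; apply: diff_derivable.
by rewrite !dE opprD addrACA.
Qed.

(** The Leibniz rule. Since [wedge] takes its 1-form on the left, b(d lambda ^ nu) is written with
    [nu] first and the arguments of [b] exchanged; moving a 1-form past a 2-form costs no sign. *)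
Lemma extd_wedge (b : {bilinear 'M[R]_(3 + 1) -> 'M[R]_(3 + 1) -> R^o})
    (lambda nu : dform M 1 'M[R]_(3 + 1)) v :
  (forall v, differentiable (fun y => lambda i y v) x) ->
  (forall v, differentiable (fun y => nu i y v) x) ->
  extd (wedge (fun X Y => b X Y) lambda nu) i x v =
  wedge (fun Y X => b X Y) nu (extd lambda) i x v -
  wedge (fun X Y => b X Y) lambda (extd nu) i x v.
Proof.
move=> dl dn; rewrite extd2E 2!wedge12E !extd1E !row_row'3.
have dE u w : 'D_u (fun y => wedge (fun X Y => b X Y) lambda nu i y w) x =
    b ('D_u (fun y => lambda i y (row 0 w)) x) (nu i x (row 1 w)) +
    b (lambda i x (row 0 w)) ('D_u (fun y => nu i y (row 1 w)) x) -
    (b ('D_u (fun y => lambda i y (row 1 w)) x) (nu i x (row 0 w)) +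
    b (lambda i x (row 1 w)) ('D_u (fun y => nu i y (row 0 w)) x)).
  rewrite (_ : (fun y => _) = (fun y => b (lambda i y (row 0 w)) (nu i y (row 1 w)))
      - (fun y => b (lambda i y (row 1 w)) (nu i y (row 0 w)))); last first.
    by apply/funext => y; rewrite wedge11E.
  by rewrite deriveB ?derive_bilin //; apply/diff_derivable/differentiable_bilin_comp.
have bBl X Y Z : b (X - Y) Z = b X Z - b Y Z by rewrite linearBl.
have bBr X Y Z : b X (Y - Z) = b X Y - b X Z by rewrite linearBr.
rewrite 3!dE {dE} !row_row'3.
move: (row 0 v) (row 1 v) (row ord_max v) => u0 u1 u2.
(* Naming the derivatives keeps unification from unfolding them. *)
have [d dE] : exists d, forall u w, 'D_u (fun y => lambda i y w) x = d u w.
  by exists (fun u w => 'D_u (fun y => lambda i y w) x).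
have [d' d'E] : exists d, forall u w, 'D_u (fun y => nu i y w) x = d u w.
  by exists (fun u w => 'D_u (fun y => nu i y w) x).
by rewrite !dE !d'E !bBl !bBr; ring.
Qed.

End FormExpansions.

Section WedgeAlgebra.
Variables (R : realType) (n : nat) (M : oriented_manifold R n).
Variables (i : mf_index M) (x : 'rV[R]_n).

Lemma eq_wedger k (U V : Type) (W : lmodType R) (b : U -> V -> W)
    (lambda : dform M 1 U) (nu rho : dform M k V) v :
  (forall w, nu i x w = rho i x w) ->
  wedge b lambda nu i x v = wedge b lambda rho i x v.
Proof. by move=> nr; apply: eq_bigr => j _; rewrite nr. Qed.

Lemma wedge_eq0 k (U V : Type) (W : lmodType R) (b : U -> V -> W)
    (lambda : dform M 1 U) (nu : dform M k V) v :
  (forall u w, b (lambda i x u) (nu i x w) = 0) -> wedge b lambda nu i x v = 0.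
Proof. by move=> b0; rewrite /wedge big1 // => j _; rewrite b0 scaler0. Qed.

Lemma wedgeDl k (U V W : lmodType R) (b : {bilinear U -> V -> W})
    (lambda mu : dform M 1 U) (nu : dform M k V) v :
  wedge b (lambda + mu) nu i x v = wedge b lambda nu i x v + wedge b mu nu i x v.
Proof.
rewrite /wedge -big_split; apply: eq_bigr => j _ /=.
by rewrite -scalerDr linearDl.
Qed.

Lemma wedgeDr k (U V W : lmodType R) (b : {bilinear U -> V -> W})
    (lambda : dform M 1 U) (nu rho : dform M k V) v :
  wedge b lambda (nu + rho) i x v = wedge b lambda nu i x v + wedge b lambda rho i x v.
Proof.
rewrite /wedge -big_split; apply: eq_bigr => j _ /=.
by rewrite -scalerDr linearDr.
Qed.

Lemma wedgeZr k (U V W : lmodType R) (b : {bilinear U -> V -> W})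
    (lambda : dform M 1 U) a (nu : dform M k V) v :
  wedge b lambda (a *: nu) i x v = a *: wedge b lambda nu i x v.
Proof.
rewrite /wedge scaler_sumr; apply: eq_bigr => j _ /=.
by rewrite linearZr_LR !scalerA mulrC.
Qed.

Lemma wedge_lieC (mu nu : dform M 1 'M[R]_(3 + 1)) w :
  wedge (@lie R) mu nu i x w = wedge (@lie R) nu mu i x w.
Proof.
by rewrite !wedge11E lie_mxC [X in _ - X]lie_mxC opprK addrC.
Qed.

(** Two signs cancel: invariance gives b(X, [Y, Z]) = -b(Y, [X, Z]), and exchanging two 1-forms
    gives another minus. With [wedge_lieC], the trilinear expression b(lambda ^ [mu, nu]) is totally
    symmetric. *)
Lemma wedge_lieCA m (b : {bilinear 'M[R]_(3 + 1) -> 'M[R]_(3 + 1) -> R^o})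
    (lambda mu nu : dform M 1 'M[R]_(3 + 1)) v :
  invariant_form m b ->
  (forall w, lambda i x w \in g_alg R m) -> (forall w, mu i x w \in g_alg R m) ->
  (forall w, nu i x w \in g_alg R m) ->
  wedge b lambda (wedge (@lie R) mu nu) i x v =
  wedge b mu (wedge (@lie R) lambda nu) i x v.
Proof.
move=> inv lg mg ng; rewrite !wedge12E !wedge11E !row_row'3.
have invE u v' w : b (lambda i x u) (lie (mu i x v') (nu i x w)) =
    - b (mu i x v') (lie (lambda i x u) (nu i x w)).
  have [_ ->] := inv _ _ _ (lg u) (mg v') (ng w).
  by rewrite lie_mxC linearNr.
have lE u v1 w1 v2 w2 :
    b (lambda i x u) (lie (mu i x v1) (nu i x w1) - lie (mu i x v2) (nu i x w2)) =
    b (mu i x v2) (lie (lambda i x u) (nu i x w2)) -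
    b (mu i x v1) (lie (lambda i x u) (nu i x w1)).
  by rewrite linearBr !invE opprK addrC.
have mE u v1 w1 v2 w2 :
    b (mu i x u) (lie (lambda i x v1) (nu i x w1) - lie (lambda i x v2) (nu i x w2)) =
    b (mu i x u) (lie (lambda i x v1) (nu i x w1)) -
    b (mu i x u) (lie (lambda i x v2) (nu i x w2)).
  exact: linearBr.
rewrite !lE !mE; ring.
Qed.

End WedgeAlgebra.

(** On [U] the function equals its projection onto the Lie algebra, and the derivative commutes with
    this linear map; likewise the coordinates are zero near [x], so their derivatives vanish. *)
Lemma derive_vanishing_coords (R : realType) (V : normedModType R) m i j (U : set V)
    (f : V -> 'M[R]_(3 + 1)) x v :
  open U -> U x -> (forall y, U y -> vanishing_coords m i j (f y)) ->
  differentiable f x -> vanishing_coords m i j ('D_v f x).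
Proof.
move=> oU Ux fU df.
have nearU (W : normedModType R) (g h : V -> W) :
    (forall y, U y -> g y = h y) -> 'D_v g x = 'D_v h x.
  move=> gh; apply: near_eq_derive; near=> y; apply: gh.
  by near: y; exact: open_nbhs_nbhs.
split=> [|k kij].
  rewrite (nearU _ _ (fun y => projv (g_alg R m) (f y))); last first.
    by move=> y /fU[fy _]; rewrite projv_id.
  by rewrite derive_linear // memv_proj.
rewrite -derive_linear // (nearU _ _ (cst 0)) ?derive_cst // => y /fU[_ /(_ k kij)].
by [].
Unshelve. all: by end_near. Qed.

(** With a single row, the conditions on the other rows compare matrices without rows, and
    multilinearity is plain linearity. *)
Lemma multilinear_row1 (R : realType) n (W : lmodType R)
    (f : 'M[R]_(1, n) -> W) a b A B :
  multilinear_rows f -> f (a *: A + b *: B) = a *: f A + b *: f B.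
Proof.
move=> fl; apply: (fl 0); last by rewrite !flatmx0.
- by rewrite linearD !linearZ.
- by rewrite !flatmx0.
Qed.

(** This makes the boundary term a smooth 2-form on the whole manifold and not just a family of
    chart expressions. *)
Lemma is_dform_wedge (R : realType) n (M : oriented_manifold R n)
    (b : {bilinear 'M[R]_(3 + 1) -> 'M[R]_(3 + 1) -> R^o})
    (lambda nu : dform M 1 'M[R]_(3 + 1)) :
  is_dform lambda -> is_dform nu -> is_dform (wedge (fun X Y => b X Y) lambda nu).
Proof.
move=> [ls lm _ lt] [ns nm _ nt].
have I2P (j : 'I_2) : j = 0 \/ j = 1.
  by case: j => [[|[|//]] ?]; [left|right]; exact/val_inj.
split.
- move=> i v k; have oU : open (chart_img M i) by exact: mf_img_open.
  apply: (Ck_on_eq oU) (_ : Ck_on k _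
    (-1 *: (fun y => b (lambda i y (row 1 v)) (nu i y (row 0 v))) +
    (fun y => b (lambda i y (row 0 v)) (nu i y (row 1 v))))).
    by move=> x _; rewrite wedge11E scaleN1r addrC.
  apply: (Ck_on_comb oU); apply: (Ck_on_bilin oU);
    by [exact: ls|exact: ns].
- move=> i x Ux j a c A B C.
  have lx u v := multilinear_row1 a c u v (lm i x Ux).
  have nx u v := multilinear_row1 a c u v (nm i x Ux).
  have bl X Y Z : b (a *: X + c *: Y) Z = a * b X Z + c * b Y Z.
    by rewrite linearDl !linearZl_LR.
  have br X Y Z : b X (a *: Y + c *: Z) = a * b X Y + c * b X Z.
    by rewrite linearDr !linearZr_LR.
  case: (I2P j) => ->.
    rewrite !row'_row2 !wedge11E => -> -> ->.
    rewrite lx nx bl br /GRing.scale /=; ring.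
  rewrite !row'_row2 !wedge11E => -> -> ->.
  rewrite lx nx bl br /GRing.scale /=; ring.
- move=> i x Ux j l A jl rA; rewrite wedge11E.
  suff -> : row 0 A = row 1 A by rewrite subrr.
  by move: jl rA; case: (I2P j) => ->; case: (I2P l) => ->; rewrite ?eqxx.
- move=> i j x Ux t v; rewrite !wedge11E !(lt _ _ _ Ux) !(nt _ _ _ Ux).
  by rewrite !row_mul.
Qed.

Section ScaleForm.
Variable R : realType.

(** A named multiple, so that it can carry the bilinear structure that the boundary term asks for:
    [a] is -1/2 on omega ^ e and 0 on the other two products. *)
Definition scale_form (a : R) (b : 'M[R]_(3 + 1) -> 'M[R]_(3 + 1) -> R^o) X Y : R^o :=
  a * b X Y.

Variable b : {bilinear 'M[R]_(3 + 1) -> 'M[R]_(3 + 1) -> R^o}.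

Lemma scale_form_bilinear a :
  bilinear_for (GRing.Scale.Law.clone _ _ *:%R _) (GRing.Scale.Law.clone _ _ *:%R _)
    (scale_form a b).
Proof.
split=> [Y|X] k Z T /=; rewrite /scale_form -[_ *: _ in RHS]mulrCA -mulrDr;
  by rewrite ?linearPl ?linearPr.
Qed.

HB.instance Definition _ a := bilinear_isBilinear.Build R _ _ R^o _ _ (scale_form a b)
  (scale_form_bilinear a).

End ScaleForm.

Lemma vanishing_coordsB (R : realType) m i j (X Y : 'M[R]_(3 + 1)) :
  vanishing_coords m i j X -> vanishing_coords m i j Y ->
  vanishing_coords m i j (X - Y).
Proof.
move=> [Xg X0] [Yg Y0]; split=> [|k kij]; first exact: rpredB.
by rewrite linearB /= X0 // Y0 // subrr.
Qed.

Lemma wedge_scale_form (R : realType) n (M : oriented_manifold R n) k a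
    (b : 'M[R]_(3 + 1) -> 'M[R]_(3 + 1) -> R^o) (lambda : dform M 1 'M[R]_(3 + 1))
    (nu : dform M k 'M[R]_(3 + 1)) :
  wedge (scale_form a b) lambda nu = a *: wedge b lambda nu.
Proof.
apply/funext => i; apply/funext => x; apply/funext => v.
rewrite /wedge !fctE scaler_sumr; apply: eq_bigr => j _.
by rewrite /scale_form scalerA mulrC -scalerA.
Qed.

Lemma boundary_formE (R : realType) (M : oriented_manifold R 3) a
    (b : {bilinear 'M[R]_(3 + 1) -> 'M[R]_(3 + 1) -> R^o})
    (omega e : dform M 1 'M[R]_(3 + 1)) :
  boundary_form (scale_form 0 b) (scale_form a b) (scale_form 0 b) omega e =
  wedge (fun X Y => scale_form a b X Y) omega e.
Proof.
by rewrite /boundary_form !wedge_scale_form !scale0r add0r addr0.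
Qed.

(** Carries the inclusions of the symmetric splitting, such as [h, p] in p, over to brackets of
    forms. *)
Lemma wedge_lie_vanishing_coords (R : realType) m n (M : oriented_manifold R n)
    (mu nu : dform M 1 'M[R]_(3 + 1)) i x w a b c d j k :
  (forall X Y : 'M[R]_(3 + 1), vanishing_coords m a b X -> vanishing_coords m c d Y ->
    vanishing_coords m j k (lie X Y)) ->
  (forall u, vanishing_coords m a b (mu i x u)) ->
  (forall u, vanishing_coords m c d (nu i x u)) ->
  vanishing_coords m j k (wedge (@lie R) mu nu i x w).
Proof.
by move=> lXY muv nuv; rewrite wedge11E; apply: vanishing_coordsB; apply: lXY.
Qed.

Lemma wedge_flip (R : realType) n (M : oriented_manifold R n) k
    (b : 'M[R]_(3 + 1) -> 'M[R]_(3 + 1) -> R^o) (lambda : dform M 1 'M[R]_(3 + 1))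
    (nu : dform M k 'M[R]_(3 + 1)) i x v :
  (forall u w, b (nu i x w) (lambda i x u) = b (lambda i x u) (nu i x w)) ->
  wedge (fun Y X => b X Y) lambda nu i x v = wedge b lambda nu i x v.
Proof. by move=> bC; apply: eq_bigr => j _; rewrite bC. Qed.

(** * Algebraic comparison of the two integrands at a point *)

Section PointwiseIdentity.
Variables (R : realType) (m : model) (M : oriented_manifold R 3).
Variables (i : mf_index M) (x : 'rV[R]_3) (v : 'M[R]_(3, 3)).
Variables omega e : dform M 1 'M[R]_(3 + 1).

Local Notation bform := {bilinear 'M[R]_(3 + 1) -> 'M[R]_(3 + 1) -> R^o}.
Local Notation brk := (wedge (@lie R)).
Local Notation W b l n := (wedge (b : bform) l n i x v).

(** The expression b(A ^ [A, A]) is a cubic form with totally symmetric polarization, so it expands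
    binomially with coefficients 1, 3, 3, 1. *)
Lemma wedge_sum_lie (b : bform) : invariant_form m b ->
  (forall w, omega i x w \in g_alg R m) -> (forall w, e i x w \in g_alg R m) ->
  W b (omega + e) (brk (omega + e) (omega + e)) =
  W b omega (brk omega omega) + 3 * W b e (brk omega omega)
  + 3 * W b e (brk omega e) + W b e (brk e e).
Proof.
move=> inv wg eg.
have lieE w : brk (omega + e) (omega + e) i x w =
    (brk omega omega + brk omega e + (brk omega e + brk e e)) i x w.
  by rewrite wedgeDl !wedgeDr [X in _ + (X + _) = _]wedge_lieC.
rewrite (eq_wedger _ _ _ lieE) wedgeDl !wedgeDr.
rewrite (wedge_lieCA v inv wg eg eg) (wedge_lieCA v inv wg wg eg).
have -> : W b omega (brk omega e) = W b e (brk omega omega).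
  rewrite (wedge_lieCA v inv eg wg wg); apply: eq_wedger => w.
  exact: wedge_lieC.
ring.
Qed.

Hypothesis omega_h : forall u, h_part m (omega i x u).
Hypothesis e_p : forall u, p_part m (e i x u).
Variables domega de : dform M 2 'M[R]_(3 + 1).
Hypothesis domega_h : forall w, h_part m (domega i x w).
Hypothesis de_p : forall w, p_part m (de i x w).
Hypothesis torsion0 : forall w, de i x w = (-1 *: brk omega e) i x w.

(** [K] stands for tr and [S] for tr*. Of the exterior derivatives only the values in h and p and
    the torsion equation enter, so [domega] and [de] are arbitrary 2-forms with these properties.
    Once the vanishing products are removed, the others count as unknown numbers in a linear
    identity. *)
Lemma tmg_cs_pointwise (K S : bform) (mu : R) : mu != 0 ->
  invariant_form m K -> invariant_form m S ->
  (forall X Y, h_part m X -> p_part m Y -> K X Y = 0) ->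
  (forall X Y, p_part m X -> h_part m Y -> K X Y = 0) ->
  (forall X Y, h_part m X -> h_part m Y -> S X Y = 0) ->
  (forall X Y, p_part m X -> p_part m Y -> S X Y = 0) ->
  - (W S e domega + 2^-1 * W S e (brk omega omega)) - 6^-1 * W S e (brk e e)
  + (2 * mu)^-1 * (W K omega domega + 3^-1 * W K omega (brk omega omega))
  - 2^-1 * (mu^-1 * W K (omega + e) (domega + de) - W S (omega + e) (domega + de)
     + 3^-1 * (mu^-1 * W K (omega + e) (brk (omega + e) (omega + e))
         - W S (omega + e) (brk (omega + e) (omega + e)))) =
  - 2^-1 * (W S e domega - W S omega de).
Proof.
move=> mu0 Kinv Sinv Khp Kph Shh Spp.
have omega_g u := (omega_h u).1; have e_g u := (e_p u).1.
have ww_h w : h_part m (brk omega omega i x w).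
  by apply: wedge_lie_vanishing_coords => //; exact: lie_hh.
have we_p w : p_part m (brk omega e i x w).
  by apply: wedge_lie_vanishing_coords => //; exact: lie_hp.
have ee_h w : h_part m (brk e e i x w).
  by apply: wedge_lie_vanishing_coords => //; exact: lie_pp.
rewrite (wedge_sum_lie Kinv) // (wedge_sum_lie Sinv) // !wedgeDl !wedgeDr.
(* The binomial 3 cancels the 1/3 of the Chern-Simons form, so [K] pairs [e] with exactly [de] +
   [omega, e]. *)
have -> : W K e de = - W K e (brk omega e).
  by rewrite (eq_wedger _ _ _ torsion0) wedgeZr scaleN1r.
have [-> ->] : W K omega de = 0 /\ W K e domega = 0.
  by split; apply: wedge_eq0 => u w; [exact: Khp|exact: Kph].
have [-> ->] : W S omega domega = 0 /\ W S e de = 0.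
  by split; apply: wedge_eq0 => u w; [exact: Shh|exact: Spp].
have [-> ->] : W K e (brk omega omega) = 0 /\ W K e (brk e e) = 0.
  by split; apply: wedge_eq0 => u w; exact: Kph.
have [-> ->] : W S omega (brk omega omega) = 0 /\ W S e (brk omega e) = 0.
  by split; apply: wedge_eq0 => u w; [exact: Shh|exact: Spp].
by field.
Qed.

End PointwiseIdentity.

(** * Exterior derivatives in a chart and the comparison on the manifold *)

Section ChartPoint.
Variables (R : realType) (m : model) (M : oriented_manifold R 3).
Variables (i : mf_index M) (x : 'rV[R]_3).
Hypothesis Ux : chart_img M i x.

Lemma dform_differentiable (lambda : dform M 1 'M[R]_(3 + 1)) v :
  is_dform lambda -> differentiable (fun y => lambda i y v) x.
Proof. by move=> [ls _ _ _]; have [dl _] := ls i v 1%N; exact: dl. Qed.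

Lemma extd_vanishing_coords j k (lambda : dform M 1 'M[R]_(3 + 1)) w :
  is_dform lambda ->
  (forall y v, chart_img M i y -> vanishing_coords m j k (lambda i y v)) ->
  vanishing_coords m j k (extd lambda i x w).
Proof.
move=> dl lv; rewrite extd1E; apply: vanishing_coordsB;
  apply: (derive_vanishing_coords (U := chart_img M i)) => //.
- exact: mf_img_open.
- by move=> y Uy; exact: lv.
- exact: dform_differentiable.
- exact: mf_img_open.
- by move=> y Uy; exact: lv.
- exact: dform_differentiable.
Qed.

End ChartPoint.

Lemma wedge_beta_form (R : realType) m (c s mu : R) o n (M : oriented_manifold R n) k
    (lambda : dform M 1 'M[R]_(3 + 1)) (nu : dform M k 'M[R]_(3 + 1)) i x v :
  wedge (beta_form m c s o mu) lambda nu i x v =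
  mu^-1 * wedge (trf m c) lambda nu i x v - wedge (trs m c s o) lambda nu i x v.
Proof.
rewrite /wedge mulr_sumr -sumrB; apply: eq_bigr => j _.
by rewrite /beta_form /GRing.scale /=; ring.
Qed.

Lemma tmg_integrandE (R : realType) m (M : oriented_manifold R 3) (c s mu : R) o
    (e omega : dform M 1 'M[R]_(3 + 1)) i x v :
  tmg_integrand m c s o mu e omega i x v =
  - (wedge (trs m c s o) e (extd omega) i x v
     + 2^-1 * wedge (trs m c s o) e (wedge (@lie R) omega omega) i x v)
  - 6^-1 * wedge (trs m c s o) e (wedge (@lie R) e e) i x v
  + (2 * mu)^-1 * (wedge (trf m c) omega (extd omega) i x v
      + 3^-1 * wedge (trf m c) omega (wedge (@lie R) omega omega) i x v).
Proof.
have -> : wedge (trs m c s o) e (extd omega) i x v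
     + 2^-1 * wedge (trs m c s o) e (wedge (@lie R) omega omega) i x v =
    wedge (trs m c s o) e (curvature omega) i x v.
  rewrite /curvature; move: (extd omega) (wedge _ omega omega) => d l.
  by rewrite wedgeDr wedgeZr.
by [].
Qed.

Lemma cs_integrandE (R : realType) (M : oriented_manifold R 3)
    (b : 'M[R]_(3 + 1) -> 'M[R]_(3 + 1) -> R^o) (A : dform M 1 'M[R]_(3 + 1)) i x v :
  cs_integrand b A i x v = 2^-1 * (wedge b A (extd A) i x v
    + 3^-1 * wedge b A (wedge (@lie R) A A) i x v).
Proof. by []. Qed.

Theorem proposition5 (R : realType) (m : model) (c s mu : R) (o : bool)
    (hc : c != 0) (hs : s != 0) (hmu : mu != 0) :
  exists b1 b2 b3 : {bilinear 'M[R]_(3 + 1) -> 'M[R]_(3 + 1) -> R^o},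
  forall (M : oriented_manifold R 3) (e omega : dform M 1 'M[R]_(3 + 1)),
    coframe m e -> torsion_free_connection m e omega ->
    is_dform (boundary_form b1 b2 b3 omega e) /\
    eq_dform
      (tmg_integrand m c s o mu e omega
       - cs_integrand (beta_form m c s o mu) (omega + e))
      (extd (boundary_form b1 b2 b3 omega e)).
Proof.
pose S : {bilinear 'M[R]_(3 + 1) -> 'M[R]_(3 + 1) -> R^o} := trs m c s o.
pose K : {bilinear 'M[R]_(3 + 1) -> 'M[R]_(3 + 1) -> R^o} := trf m c.
exists (scale_form 0 S), (scale_form (- 2^-1) S), (scale_form 0 S).
move=> M e omega [de ep _] [dw wh tors]; rewrite boundary_formE.
split; first exact: is_dform_wedge.
move=> i x Ux v.
have e_p y u : chart_img M i y -> p_part m (e i y u) by move=> Uy; apply/in_pP/ep.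
have omega_h y u : chart_img M i y -> h_part m (omega i y u).
  by move=> Uy; apply/in_hP/wh.
have dfe u := dform_differentiable Ux u de.
have dfw u := dform_differentiable Ux u dw.
have dsumE w : extd (omega + e) i x w = (extd omega + extd e) i x w by exact: extdD.
have torsion0 w : extd e i x w = (-1 *: wedge (@lie R) omega e) i x w.
  by apply/eqP; rewrite !fctE scaleN1r -addr_eq0; apply/eqP; exact: (tors i x Ux w).
have de_p w : p_part m (extd e i x w).
  by apply: extd_vanishing_coords => // y u; exact: e_p.
have domega_h w : h_part m (extd omega i x w).
  by apply: extd_vanishing_coords => // y u; exact: omega_h.
rewrite extd_wedge //.
transitivity (tmg_integrand m c s o mu e omega i x v
    - cs_integrand (beta_form m c s o mu) (omega + e) i x v); first by [].
rewrite tmg_integrandE cs_integrandE (eq_wedger _ _ _ dsumE) !wedge_beta_form.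
rewrite -[trf m c]/(K : _ -> _ -> _) -[trs m c s o]/(S : _ -> _ -> _).
have Kinv : invariant_form m K by exact: trf_invariant.
have Sinv : invariant_form m S by exact: trs_invariant.
have Khp X Y : h_part m X -> p_part m Y -> K X Y = 0 by exact: trf_hp.
have Kph X Y : p_part m X -> h_part m Y -> K X Y = 0 by exact: trf_ph.
have Shh X Y : h_part m X -> h_part m Y -> S X Y = 0 by exact: trs_hh.
have Spp X Y : p_part m X -> p_part m Y -> S X Y = 0 by exact: trs_pp.
(* From here on the two forms are known only through invariance and their vanishing on the
   splitting. *)
clearbody K S.
move: (extd omega) (extd e) torsion0 de_p domega_h {dsumE} => domega dext.
move=> torsion0 de_p domega_h.
transitivity (- 2^-1 * (wedge S e domega i x v - wedge S omega dext i x v)).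
  apply: (@tmg_cs_pointwise R m M i x v omega e _ _ domega dext _ _ _ K S mu) => //.
  - by move=> u; exact: omega_h.
  - by move=> u; exact: e_p.
(* The Leibniz rule has produced tr*(d omega ^ e) with the arguments of the form exchanged; symmetry
   on the Lie algebra restores their order. *)
rewrite (@wedge_flip _ _ _ _ (scale_form (- 2^-1) S)); last first.
  move=> u w; congr (_ * _).
  exact: (Sinv _ _ _ (domega_h w).1 (e_p x u Ux).1 (e_p x u Ux).1).1.
by rewrite !wedge_scale_form !fctE -scalerBr.
Qed.
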